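(* Let $n\ge5$ and let $P^n_\omega$ be an edge-weighted path with vertices $x_1,\dots,x_n$, edges $e_i=\{x_i,x_{i+1}\}$ and weights $\omega_i=\omega(e_i)$, whose edge ideal $I=I(P^n_\omega)\subseteq S=\mathbb{K}[x_1,\dots,x_n]$ is integrally closed. Suppose $\omega_1>\omega_3$ and $\omega_i=1$ for all $i\ne1,3$. Then for every $t\ge1$: (1) if $\omega_3=1$, then $\operatorname{depth}(S/I^t)\ge\max\{\lceil\frac{n-t+1}{3}\rceil,1\}$; (2) if $\omega_3>1$, then $\operatorname{depth}(S/I^t)\ge\max\{\lceil\frac{n-t+1}{3}\rceil,2\}$.
   Context: $\mathbb{K}$ is a field. For a simple graph $G$ with weight function $\omega:E(G)\to\mathbb{Z}_{>0}$, $I(G_\omega)=(x_i^{\omega(e)}x_j^{\omega(e)}\mid e=\{x_i,x_j\}\in E(G))$. An ideal is integrally closed if it equals its integral closure. *)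

(* Defs.v *)
From HB Require Import structures.
From mathcomp Require Import all_boot all_order all_algebra.
From mathcomp Require Import mpoly.

Set Implicit Arguments.
Unset Strict Implicit.
Unset Printing Implicit Defensive.

Import GRing.Theory.
Local Open Scope ring_scope.

Section Defs.
Variables (K : fieldType) (n : nat).
Local Notation S := {mpoly K[n]}.

Definition in_ideal (G : seq S) (p : S) : Prop :=
  exists c : 'I_(size G) -> S, p = \sum_(i < size G) c i * G`_i.

Fixpoint pow_gens (G : seq S) (t : nat) : seq S :=
  if t is t'.+1 then [seq g * h | g <- G, h <- pow_gens G t'] else [:: 1].

(* The variable x_k, 1 <= k <= n (paper indexing); 0 outside this range. *)
Definition xvar (k : nat) : S :=
  oapp (fun j : 'I_n => 'X_j) 0 (insub k.-1).

Definition in_max_ideal (p : S) : Prop := p@_0%MM = 0.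

Definition integral_over (G : seq S) (p : S) : Prop :=
  exists (k : nat) (a : nat -> S),
    (0 < k)%N /\
    (forall i, (1 <= i <= k)%N -> in_ideal (pow_gens G i) (a i)) /\
    p ^+ k + \sum_(1 <= i < k.+1) a i * p ^+ (k - i) = 0.

Definition integrally_closed (G : seq S) : Prop :=
  forall p, integral_over G p -> in_ideal G p.

Definition regular_seq (G : seq S) (s : seq S) : Prop :=
  (forall f, f \in s -> in_max_ideal f) /\
  (forall i, (i < size s)%N ->
     forall g, in_ideal (G ++ take i s) (s`_i * g) ->
               in_ideal (G ++ take i s) g) /\
  ~ in_ideal (G ++ s) 1.

(* depth(S/(G)) >= d : there is an S/(G)-regular sequence in m of length d
   (depth = common length of maximal regular sequences in m). *)
Definition depth_ge (G : seq S) (d : nat) : Prop :=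
  exists s : seq S, size s = d /\ regular_seq G s.

Definition wpath_gens (w : nat -> nat) : seq S :=
  [seq (xvar i * xvar i.+1) ^+ w i | i <- iota 1 n.-1].

End Defs.

(* Main.v *)
Require Import Defs.
From HB Require Import structures.
From mathcomp Require Import all_boot all_order all_algebra.
From mathcomp Require Import mpoly zify ring.

(* Filter S/I^t by quotients S/P, with P generated by variables, such that at
   least d variables lie outside every P. The elementary symmetric polynomials
   e_d, ..., e_1 form a regular sequence on each such polynomial ring S/P, hence,
   by the exact sequences of the filtration, on S/I^t.

   Write I_m for the ideal of the path on x_1, ..., x_m. When the last edge
   x_(m-1) x_m has weight 1, I_m^t : x_(m-1) x_m = I_m^(t-1). Killing x_(m-1)
   leaves I_(m-2)^t with x_m free, and killing x_m after dividing by x_(m-1)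
   leaves I_(m-1)^t : x_(m-1), to which the same analysis applies; its pieces are
   I_(m-1)^(t-1), and I_(m-3)^t with x_(m-1) free. These steps reach all short
   paths by induction on m and t. The one substantial base case is four vertices
   with both w_1, w_3 > 1, where the slices of I_4^t in x_2 or x_3 are principal. *)

Set Implicit Arguments.
Unset Strict Implicit.
Unset Printing Implicit Defensive.

Import GRing.Theory.

(** * Weakly regular sequences modulo an ideal *)

Section Ideals.
Local Open Scope ring_scope.
Variables (K : fieldType) (n : nat).
Local Notation S := {mpoly K[n]}.
Implicit Types (J : S -> Prop) (f g p q u : S) (s : seq S).

Definition is_ideal J : Prop :=
  [/\ J 0, forall p q, J p -> J q -> J (p + q) & forall r p, J p -> J (r * p)].

Definition adjoin J f p : Prop := exists h, J (p - h * f).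

(** The last quotient may be zero, so that pieces of a filtration are allowed to vanish; properness
    is checked separately in [depth_ge_wpath]. *)
Fixpoint weakly_regular J s : Prop :=
  if s is f :: s' then
    (forall g, J (f * g) -> J g) /\ weakly_regular (adjoin J f) s'
  else True.

Lemma ideal_opp J p : is_ideal J -> J p -> J (- p).
Proof. by case=> _ _ JM Jp; rewrite -mulN1r; apply: JM. Qed.

Lemma ideal_sub J p q : is_ideal J -> J p -> J q -> J (p - q).
Proof. by move=> idJ Jp Jq; case: (idJ) => _ JD _; apply: JD => //; apply: ideal_opp. Qed.

Lemma ideal_adjoin J f : is_ideal J -> is_ideal (adjoin J f).
Proof.
case=> J0 JD JM; split=> [|p q [h Jh] [k Jk]|r p [h Jh]].
- by exists 0; rewrite mul0r subrr.
- exists (h + k); have ->: p + q - (h + k) * f = (p - h * f) + (q - k * f) by ring.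
  exact: JD.
- exists (r * h); have ->: r * p - r * h * f = r * (p - h * f) by ring.
  exact: JM.
Qed.

Lemma sub_adjoin J f p : J p -> adjoin J f p.
Proof. by move=> Jp; exists 0; rewrite mul0r subr0. Qed.

Lemma eq_adjoin J J' f :
  (forall p, J p <-> J' p) -> forall p, adjoin J f p <-> adjoin J' f p.
Proof. by move=> eJ p; split=> -[h Jh]; exists h; apply/eJ. Qed.

Lemma adjoinAC J f g p : adjoin (adjoin J f) g p -> adjoin (adjoin J g) f p.
Proof.
move=> [h [k Jk]]; exists k, h.
by have ->: p - k * f - h * g = p - h * g - k * f by ring.
Qed.

Lemma eq_weakly_regular J J' s :
  (forall p, J p <-> J' p) -> weakly_regular J s -> weakly_regular J' s.
Proof.
elim: s J J' => [//|f s IHs] J J' eJ /= [Jf Js]; split.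
  by move=> g /eJ/Jf/eJ.
by apply: IHs Js => p; apply: eq_adjoin.
Qed.

Lemma weakly_regular_total J s : (forall p, J p) -> weakly_regular J s.
Proof.
elim: s J => [//|f s IHs] J Jp /=; split=> //.
by apply: IHs => p; apply: sub_adjoin.
Qed.

Lemma eq_mod_adjoin J f g : is_ideal J -> J (f - g) ->
  forall p, adjoin J g p -> adjoin J f p.
Proof.
move=> idJ Jfg p [h Jh]; exists h; case: (idJ) => _ JD JM.
have ->: p - h * f = (p - h * g) - h * (f - g) by ring.
by apply: ideal_sub => //; apply: JM.
Qed.

(* The exact sequence [0 -> S/(J : u) -> S/J -> S/(J + u) -> 0]: a sequence
   regular on the two outer terms is regular on the middle one. *)
Lemma weakly_regular_filtration J u s : is_ideal J ->
  weakly_regular (fun p => J (u * p)) s -> weakly_regular (adjoin J u) s ->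
  weakly_regular J s.
Proof.
elim: s J => [//|f s IHs] J idJ /= [cf cs] [af as_]; case: (idJ) => J0 JD JM.
split=> [g Jfg|].
  have [h Jh] := af g (sub_adjoin u Jfg).
  have Jh': J (u * h).
    apply: cf; have ->: u * (f * h) = f * g - f * (g - h * u) by ring.
    by apply: ideal_sub => //; apply: JM.
  have ->: g = (g - h * u) + u * h by ring.
  exact: JD.
apply: IHs; first exact: ideal_adjoin.
(* Here [(J + f) : u = (J : u) + f]: if [u * p = q * f] modulo [J], then [q] lies in [J + u],
   because [f] is regular modulo [J + u]. *)
- apply: eq_weakly_regular cs => p; split=> [[h Jh]|[q Jq]].
    exists (u * h); have ->: u * p - u * h * f = u * (p - h * f) by ring.
    by [].
  have [r Jr]: adjoin J u q.
    apply: af; exists p; have ->: f * q - p * u = - (u * p - q * f) by ring.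
    exact: ideal_opp.
  exists r; have ->: u * (p - r * f) = (u * p - q * f) + f * (q - r * u) by ring.
  by apply: JD => //; apply: JM.
- by apply: eq_weakly_regular as_ => p; split; apply: adjoinAC.
Qed.

(** Only the component of [g] in degree [d] can reach degree [k + d]. *)
Lemma pihomogM k d f g : f \is k.-homog ->
  pihomog mdeg (k + d) (f * g) = f * pihomog mdeg d g.
Proof.
move=> hf; pose N := maxn (msize g) d.+1.
have Ng: (msize g <= N)%N by exact: leq_maxl.
rewrite {1}(pihomog_partitionE Ng) mulr_sumr linear_sum /=.
have dN: (d < N)%N by exact: leq_maxr.
rewrite (bigD1 (Ordinal dN)) //= pihomog_dE ?dhomogM ?pihomogP //.
rewrite big1 ?addr0 // => i ni.
apply: (@pihomog_ne0 _ _ _ (k + i)%N); last by rewrite dhomogM ?pihomogP.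
by rewrite eqn_add2l.
Qed.

Lemma pihomogM_lt k d f g : f \is k.-homog -> (d < k)%N ->
  pihomog mdeg d (f * g) = 0.
Proof.
move=> hf dk; rewrite {1}(pihomog_partitionE (leqnn (msize g))) mulr_sumr linear_sum /=.
rewrite big1 // => i _.
apply: (@pihomog_ne0 _ _ _ (k + i)%N); last by rewrite dhomogM ?pihomogP.
by rewrite neq_ltn (leq_trans dk) ?leq_addr ?orbT.
Qed.

Definition homog_ideal J : Prop := forall p d, J p -> J (pihomog mdeg d p).

Lemma homog_adjoin J f k : is_ideal J -> homog_ideal J -> f \is k.-homog ->
  homog_ideal (adjoin J f).
Proof.
move=> idJ hJ hf p d [h Jh]; have := hJ _ d Jh; rewrite linearB /= mulrC.
have [dk|kd] := ltnP d k.
  by rewrite (pihomogM_lt _ hf) // subr0; apply: sub_adjoin.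
rewrite -[X in pihomog _ X (f * h)](subnKC kd) pihomogM // mulrC => Jd.
by exists (pihomog mdeg (d - k) h).
Qed.

(* Regular sequences of homogeneous elements may be permuted: here [x] is moved
   from the front of the sequence to the back and then forgotten. *)
Lemma weakly_regular_drop J x s k : is_ideal J -> homog_ideal J ->
  x \is k.+1.-homog -> (forall f, f \in s -> exists e, f \is e.-homog) ->
  (forall g, J (x * g) -> J g) -> weakly_regular (adjoin J x) s ->
  weakly_regular J s.
Proof.
move=> + + hx; elim: s J => [//|f s IHs] J idJ hJ hs /= Jx [af as_].
have [e hf] := hs f (mem_head _ _).
case: (idJ) => J0 JD JM.
(* Graded Nakayama: modulo [J], [g = x * h'] with [h'] of smaller degree, since [x] has positive
   degree. Cancelling [x] puts [f * h'] in [J], and the induction applies to [h']. *)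
have Jf d : forall g, g \is d.-homog -> J (f * g) -> J g.
  elim/ltn_ind: d => d IHd g hg Jfg.
  have [h Jh] := af g (sub_adjoin x Jfg).
  have := hJ _ d Jh; rewrite linearB /= (pihomog_dE hg) mulrC.
  have [dk|kd] := ltnP d k.+1.
    by rewrite (pihomogM_lt _ hx) // subr0.
  rewrite -[X in pihomog _ X (x * h)](subnKC kd) pihomogM //.
  set h' := pihomog _ _ h => Jgd.
  have Jh': J h'.
    apply: (IHd (d - k.+1)%N); [by lia|exact: pihomogP|].
    apply: Jx; have ->: x * (f * h') = f * g - f * (g - x * h') by ring.
    by apply: ideal_sub => //; apply: JM.
  have ->: g = (g - x * h') + x * h' by ring.
  by apply: JD => //; apply: JM.
have Jf' g : J (f * g) -> J g.
  move=> Jfg; rewrite (pihomog_partitionE (leqnn (msize g))).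
  elim/big_ind: _ => // d _; apply: (Jf d); first exact: pihomogP.
  by rewrite -(pihomogM _ _ hf); apply: hJ.
split=> //; apply: IHs => //.
- exact: ideal_adjoin.
- exact: homog_adjoin hf.
- by move=> f' f's; apply: hs; rewrite inE f's orbT.
(* [x] stays regular modulo [J + f]: if [x * g = q * f] modulo [J], then [q = r * x] modulo [J], and
   [x] cancels. *)
- move=> g [q Jq].
  have [r Jr]: adjoin J x q.
    apply: af; exists g; have ->: f * q - g * x = - (x * g - q * f) by ring.
    exact: ideal_opp.
  exists r; apply: Jx.
  have ->: x * (g - r * f) = (x * g - q * f) + f * (q - r * x) by ring.
  by apply: JD => //; apply: JM.
- by apply: eq_weakly_regular as_ => p; split; apply: adjoinAC.
Qed.

End Ideals.

(** * Monomial ideals and elementary symmetric polynomials *)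

Section MonomialIdeals.
Local Open Scope ring_scope.
Variables (K : fieldType) (n : nat).
Local Notation S := {mpoly K[n]}.
Local Notation mnm := 'X_{1..n}.
Implicit Types (U V : mnm -> Prop) (F A : {set 'I_n}) (u v m : mnm) (p q : S).

Definition up_closed U : Prop := forall m v, U m -> U (m + v)%MM.

(** A monomial ideal is encoded by the set of its exponents, so that colons by monomials and sums
    with them become operations on such sets. *)
Definition monomial_ideal U p : Prop := forall m, m \in msupp p -> U m.

Lemma ideal_monomial U : up_closed U -> is_ideal (monomial_ideal U).
Proof.
move=> upU; split=> [m|p q Up Uq m|r p Up m].
- by rewrite msupp0.
- by move/msuppD_le; rewrite mem_cat => /orP[/Up|/Uq].
- by move/msuppM_le/allpairsP=> [[u v] /= [_ /Up Uv ->]]; rewrite addmC; apply: upU.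
Qed.

Lemma homog_monomial U : homog_ideal (monomial_ideal U).
Proof.
move=> p d Up m; rewrite pihomogE => /msupp_sum_le/flattenP[s /mapP[u]].
by rewrite mem_filter => /andP[_ /Up Uu] -> /msuppZ_le; rewrite msuppX inE => /eqP->.
Qed.

Lemma eq_monomial U V : (forall m, U m <-> V m) ->
  forall p, monomial_ideal U p <-> monomial_ideal V p.
Proof. by move=> eUV p; split=> Up m /Up/eUV. Qed.

Lemma monomial_colon U u p :
  monomial_ideal U ('X_[u] * p) <-> monomial_ideal (fun m => U (m + u)%MM) p.
Proof.
rewrite mulrC; split=> Up m mp.
  by apply: Up; rewrite (perm_mem (msuppMX _ _)) addmC; apply: map_f.
by move: mp; rewrite (perm_mem (msuppMX _ _)) => /mapP[v /Up Uv ->]; rewrite addmC.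
Qed.

Lemma monomial_adjoin U u p : up_closed U ->
  adjoin (monomial_ideal U) 'X_[u] p <->
  monomial_ideal (fun m => U m \/ (u <= m)%MM) p.
Proof.
move=> upU; split=> [[h Uh] m mp|Up].
  have [/Uh Um|] := boolP (m \in msupp (p - h * 'X_[u])); first by left.
  rewrite -mcoeff_eq0 mcoeffB subr_eq0 => /eqP pm; right.
  have: m \in msupp (h * 'X_[u]) by rewrite mcoeff_msupp -pm -mcoeff_msupp.
  by rewrite (perm_mem (msuppMX _ _)) => /mapP[v _ ->]; rewrite lem_addr.
(* [h * 'X_[u]] gathers the terms of [p] divisible by ['X_[u]]. *)
pose h : S := \sum_(m <- msupp p | (u <= m)%MM) p@_m *: 'X_[m - u].
exists h; have ->: p - h * 'X_[u] = \sum_(m <- msupp p | ~~ (u <= m)%MM) p@_m *: 'X_[m].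
  rewrite {1}[p]mpolyE (bigID (fun m => (u <= m)%MM)) /= addrC mulr_suml.
  set a := (X in _ + X - _); set b := (X in _ + _ - X).
  suff ->: a = b by rewrite addrK.
  by apply: eq_bigr => m um; rewrite -scalerAl -mpolyXD submK.
move=> m /msupp_sum_le/flattenP[s /mapP[v]].
rewrite mem_filter => /andP[/negbTE nuv /Up]; rewrite nuv => -[Uv|//] ->.
by move/msuppZ_le; rewrite msuppX inE => /eqP->.
Qed.

(** Membership in the prime ideal generated by the variables in [F]; the monomials that do not meet
    [F] form a basis of the quotient ring. *)
Definition meets F m : bool := [exists j in F, (0 < m j)%N].

Lemma meetsP F m : reflect (exists2 j, j \in F & 0 < m j)%N (meets F m).
Proof. exact: exists_inP. Qed.

Lemma meetsPn F m : reflect (forall j, j \in F -> m j = 0%N) (~~ meets F m).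
Proof.
apply: (iffP exists_inPn) => Fm j /Fm; first by rewrite lt0n negbK => /eqP.
by move=> ->.
Qed.

Lemma up_closed_meets F : up_closed (meets F).
Proof.
move=> m v /meetsP[j jF mj]; apply/meetsP; exists j => //.
by rewrite mnmDE ltn_addr.
Qed.

Lemma meetsU1 F j m : meets (j |: F) m = (0 < m j)%N || meets F m.
Proof.
apply/meetsP/orP=> [[i /setU1P[->|iF] mi]|[mj|/meetsP[i iF mi]]].
- by left.
- by right; apply/meetsP; exists i.
- by exists j; rewrite ?setU11.
- by exists i; rewrite // setU1r.
Qed.

(** The order is decreasing because, once only [d] variables are left, the first element [e_d] is
    their product, a monomial. *)
Fixpoint mesyms d : seq S := if d is d'.+1 then mesym n K d :: mesyms d' else [::].

Lemma size_mesyms d : size (mesyms d) = d.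
Proof. by elim: d => //= d ->. Qed.

Lemma mem_mesyms d f : f \in mesyms d -> exists2 e, (0 < e)%N & f = mesym n K e.
Proof. by elim: d => //= d IHd; rewrite inE => /orP[/eqP->|/IHd//]; exists d.+1. Qed.

(* Regularity of [e_d, ..., e_1] modulo [U] and the variables in [F]. *)
Definition mesym_regular d F U : Prop :=
  weakly_regular (monomial_ideal (fun m => U m \/ meets F m)) (mesyms d).

(** * Filtration rules for monomial ideals *)

Section Rules.
Variable d : nat.

Lemma mesym_regular_ext F U V :
  (forall m, ~~ meets F m -> U m <-> V m) ->
  mesym_regular d F U -> mesym_regular d F V.
Proof.
move=> eUV; apply: eq_weakly_regular; apply: eq_monomial => m.
by have [|/eUV] := boolP (meets F m); [split; right|tauto].
Qed.

Lemma mesym_regular_total F U : (forall m, ~~ meets F m -> U m) ->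
  mesym_regular d F U.
Proof.
move=> Ut; apply: weakly_regular_total => p m _.
by have [|/Ut] := boolP (meets F m); [right|left].
Qed.

(** Since ['X_[u]] involves no variable of [F], the colon by it leaves the part generated by [F]
    unchanged. *)
Lemma mesym_regular_split u F U : up_closed U -> ~~ meets F u ->
  mesym_regular d F (fun m => U (m + u)%MM) ->
  mesym_regular d F (fun m => U m \/ (u <= m)%MM) -> mesym_regular d F U.
Proof.
move=> upU Fu Uc Ua.
have up: up_closed (fun m => U m \/ meets F m).
  by move=> m v [/upU|/up_closed_meets]; [left|right].
apply: (weakly_regular_filtration (u := 'X_[u]) (ideal_monomial up)).
  apply: eq_weakly_regular Uc => p; rewrite monomial_colon.
  apply: eq_monomial => m.
  suff ->: meets F (m + u) = meets F m by [].
  apply: eq_existsb_in => j jF.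
  by rewrite mnmDE (meetsPn _ _ Fu) // addn0.
apply: eq_weakly_regular Ua => p; rewrite monomial_adjoin //.
by apply: eq_monomial => m; tauto.
Qed.

Lemma mesym_regular_var j F U :
  mesym_regular d (j |: F) U ->
  mesym_regular d F (fun m => U m \/ (U_(j) <= m)%MM).
Proof.
apply: eq_weakly_regular; apply: eq_monomial => m.
rewrite meetsU1 lep1mP -lt0n; split.
  by case=> [?|/orP[?|?]]; auto.
by case=> [[?|->]|->]; rewrite ?orbT; auto.
Qed.

Lemma mesym_regular_split_var j F U : up_closed U -> j \notin F ->
  mesym_regular d F (fun m => U (m + U_(j))%MM) ->
  mesym_regular d (j |: F) U -> mesym_regular d F U.
Proof.
move=> upU jF Uc Ua; apply: (mesym_regular_split (u := U_(j)%MM)) => //.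
  by apply/meetsPn=> i iF; rewrite mnm1E; case: eqP iF jF => // <- ->.
exact: mesym_regular_var.
Qed.

Lemma up_closed_shift U u : up_closed U -> up_closed (fun m => U (m + u)%MM).
Proof. by move=> upU m v /(upU _ v); rewrite -!addmA (addmC u). Qed.

Lemma up_closedU U V : up_closed U -> up_closed V ->
  up_closed (fun m => U m \/ V m).
Proof. by move=> upU upV m v [/upU|/upV]; auto. Qed.

Lemma up_closed_le u : up_closed (fun m => (u <= m)%MM).
Proof. by move=> m v /lepm_trans->; rewrite ?lem_addr. Qed.

(** Repeated splitting at [x_j]: since [x_j] is killed in the pieces over [j |: F], the piece
    numbered [k] is the slice of [U] at exponent [k]. The colon by [x_j^N] remains. *)
Lemma mesym_regular_slices j N F U : up_closed U -> j \notin F ->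
  mesym_regular d F (fun m => U (m + U_(j) *+ N)%MM) ->
  (forall k, (k < N)%N ->
     mesym_regular d (j |: F) (fun m => U (m + U_(j) *+ k)%MM)) ->
  mesym_regular d F U.
Proof.
move=> upU jF; elim: N => [|N IHN] UN Uk.
  by apply: mesym_regular_ext UN => m _; rewrite mulm0n addm0.
apply: IHN => [|k kN]; last by apply: Uk; apply: ltnW.
apply: (mesym_regular_split_var (j := j)) => //; last exact: Uk.
  exact: up_closed_shift.
by apply: mesym_regular_ext UN => m _; rewrite -addmA -mulmS.
Qed.

(** These are quotients by [F] alone, polynomial rings in at least [d] variables. The claim serves
    as a hypothesis below because the principal case for [d] enters its proof for [d + 1]. *)
Definition polynomial_rings_regular : Prop :=
  forall F U, (forall m, ~~ meets F m -> ~ U m) -> (#|F| + d <= n)%N ->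
  mesym_regular d F U.

Hypothesis regP : polynomial_rings_regular.

(** Dividing [u] by its variables one at a time filters the quotient by polynomial rings with one
    more variable killed, whence the summand 1 in the bound. *)
Lemma mesym_regular_principal u F U :
  (forall m, ~~ meets F m -> U m <-> (u <= m)%MM) -> ~~ meets F u ->
  (#|F| + 1 + d <= n)%N -> mesym_regular d F U.
Proof.
move=> Uu Fu Fd; apply: (@mesym_regular_ext _ (fun m => (u <= m)%MM)) => [m /Uu->//|].
move: {U Uu} Fu; have [k uk] := ubnP (mdeg u); elim: k u uk => // k IHk u uk Fu.
have [->|nu0] := eqVneq u 0%MM.
  by apply: mesym_regular_total => m _; apply/mnm_lepP=> i; rewrite mnm0E.
have [j uj]: exists j, (0 < u j)%N.
  apply/existsP; apply: contraR nu0; rewrite negb_exists => /forallP u0.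
  by apply/eqP/mnmP=> j; move: (u0 j); rewrite mnm0E lt0n negbK => /eqP.
have jF : j \notin F by apply: contraL uj => jF; rewrite (meetsPn _ _ Fu) ?lt0n.
have ju : (U_(j) <= u)%MM by rewrite lep1mP -lt0n.
apply: (mesym_regular_split_var (j := j)) => //; first exact: up_closed_le.
  apply: (@mesym_regular_ext _ (fun m => (u - U_(j) <= m)%MM)) => [m _|].
    split=> /mnm_lepP um; apply/mnm_lepP=> i; move: (um i).
      by rewrite mnmBE mnmDE leq_subLR addnC.
    by rewrite mnmBE mnmDE leq_subLR addnC.
  apply: IHk.
    by move: uk; rewrite -{1}(submK ju) mdegD mdeg1 addn1 ltnS.
  by apply/meetsPn=> i iF; rewrite mnmBE (meetsPn _ _ Fu).
apply: regP => [m|]; last by rewrite cardsU1 jF; lia.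
rewrite meetsU1 negb_or -leqNgt leqn0 => /andP[/eqP mj _] /mnm_lepP/(_ j).
by rewrite mj leqNgt uj.
Qed.

End Rules.

(** Induction on [d], then on the number of variables outside [F]. In the step to [d + 1], as long
    as there are more than [d + 1] of them, one is killed by means of [weakly_regular_drop]. *)
Lemma mesym_polynomial_rings d : polynomial_rings_regular d.
Proof.
elim: d => [//|d IHd] F U U0.
have [k nk] := ubnP (n - #|F|); elim: k F U U0 nk => // k IHk F U U0 nk Fd.
apply: (@mesym_regular_ext _ _ (fun=> False)) => [m /U0//|].
have upF : up_closed (fun m => False \/ meets F m).
  by move=> m v [//|/up_closed_meets]; right.
have [eF|nF] := eqVneq (#|F| + d.+1)%N n; last first.
  have [j jF]: exists j, j \notin F.
    apply/existsP; rewrite -negb_forall; apply: contra nF => /forallP FT.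
    have /eqP: F = setT by apply/setP=> i; rewrite FT inE.
    by rewrite eqEcard cardsT card_ord => /andP[_]; lia.
  apply: (weakly_regular_drop (x := 'X_j) (k := 0)) => /=.
  - exact: ideal_monomial.
  - exact: homog_monomial.
  - by rewrite dhomogX /= mdeg1.
  - move=> f fs; have [e _ ->]: exists2 e, (0 < e)%N & f = mesym n K e.
      exact: (@mem_mesyms d.+1).
    by exists e; apply: dhomog_mesym.
  - move=> g; rewrite monomial_colon; apply: (proj1 (eq_monomial _ _)) => m.
    have ->// : meets F (m + U_(j)) = meets F m.
    apply: eq_existsb_in => i iF; rewrite mnmDE mnm1E.
    by case: eqP iF jF => [<- ->|_ _ _] //; rewrite addn0.
  - have: mesym_regular d.+1 (j |: F) (fun=> False).
      by apply: IHk => [m _ []||]; rewrite cardsU1 jF; lia.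
    apply: eq_weakly_regular => p; rewrite monomial_adjoin //.
    by apply: eq_monomial => m; rewrite meetsU1 lep1mP -lt0n; split;
      [case=> // /orP[]|case=> [[]|]] => //; auto => ->; rewrite ?orbT; auto.
(* Exactly [d + 1] variables are left. Modulo [F], [e_(d+1)] is their product ['X_[T]], as every
   other set of [d + 1] variables meets [F]; the principal case for [d] finishes. *)
pose T := mesym1 (~: F).
have cT : #|~: F| = d.+1 by have := cardsC F; rewrite card_ord; lia.
have FT : ~~ meets F T by apply/meetsPn=> i iF; rewrite mnmE inE iF.
have idF := ideal_monomial upF.
pose J := monomial_ideal (fun m => False \/ meets F m).
have eT : J (mesym n K d.+1 - 'X_[T]).
  rewrite mesymE (bigD1 (~: F)) ?cT //= -/T [_ + \sum_(_ | _) _]addrC addrK => m.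
  move=> /msupp_sum_le/flattenP[s /mapP[A]].
  rewrite mem_filter => /andP[/andP[/eqP cA nA] _] ->; rewrite msuppX inE => /eqP->.
  right; apply: contraNT nA => /meetsPn Am; rewrite eqEcard cT cA leqnn andbT.
  by apply/subsetP=> i iA; rewrite inE; apply/negP=> /Am; rewrite mnmE iA.
case: (idF) => J0 JD JM; split=> [g Jg|].
  have: J ('X_[T] * g).
    have ->: 'X_[T] * g = mesym n K d.+1 * g - g * (mesym n K d.+1 - 'X_[T]) by ring.
    by apply: (ideal_sub idF) => //; apply: JM.
  rewrite /J monomial_colon; apply: (proj1 (eq_monomial _ _)) => m.
  have ->// : meets F (m + T) = meets F m.
  by apply: eq_existsb_in => i iF; rewrite mnmDE (meetsPn _ _ FT) // addn0.
have: mesym_regular d F (fun m => False \/ (T <= m)%MM).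
  by apply: (mesym_regular_principal IHd (u := T)) => //; [tauto|lia].
apply: eq_weakly_regular => p; rewrite -/J.
transitivity (adjoin J 'X_[T] p).
  by rewrite monomial_adjoin //; apply: eq_monomial => m; tauto.
split; apply: eq_mod_adjoin => //.
by rewrite -opprB; apply: (ideal_opp idF).
Qed.

End MonomialIdeals.

(** * Exponent vectors of powers of path ideals *)

Section PathPowers.
Variable w : nat -> nat.
Implicit Types (a b c : nat -> nat) (r t k : nat).

(* [a] is the exponent vector of an element of [I(P^r_w)^t], the edge
   [{x_k, x_{k+1}}] being used [c k] times. *)
Definition path_power r t a : Prop := exists c,
  [/\ forall k, r <= k -> c k = 0,
      forall k, 0 < k -> w k.-1 * c k.-1 + w k * c k <= a k
    & t <= \sum_(1 <= i < r) c i].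

Lemma path_power0 r a : path_power r 0 a.
Proof. by exists (fun=> 0); split=> // k _; rewrite !muln0. Qed.

Lemma path_power_le r t a b : (forall k, 0 < k <= r -> a k <= b k) ->
  path_power r t a -> path_power r t b.
Proof.
move=> ab [c [c0 ca ct]]; exists c; split=> // k k0.
have [kr|rk] := leqP k r; first by apply: leq_trans (ca k k0) (ab k _); rewrite k0.
by rewrite !c0 ?muln0; lia.
Qed.

Lemma path_power_leaf_colon r t a b : w r.+2 = 1 -> 0 < w r.+1 ->
  (forall k, 0 < k <= r.+3 -> b k = a k + (k == r.+2) + (k == r.+3)) ->
  path_power r.+3 t.+1 b <-> path_power r.+3 t a.
Proof.
move=> w2 w1 ab; split=> [[c [c0 cb ct]]|[c [c0 ca ct]]].
- pose c' k := if k == r.+2 then (c k).-1 else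
               if k == r.+1 then c k - (c r.+2 == 0) else c k.
  exists c'; split=> [k rk|k k0|].
  + by rewrite /c'; do 2 (case: eqP => [|_]; first by lia); apply: c0.
  + have [kr|rk] := leqP k r.+3; last first.
      by rewrite /c'; do 4 (case: eqP => [|_]; first by lia); rewrite !c0; lia.
    have ck j : c' j <= c j.
      rewrite /c'; case: ifP => _; first exact: leq_pred.
      by case: ifP => _ //; apply: leq_subr.
    have := cb k k0; rewrite ab ?k0 //.
    have := leq_mul (leqnn (w k.-1)) (ck k.-1); have := leq_mul (leqnn (w k)) (ck k).
    have [ek2|nk2] := eqVneq k r.+2; [|have [ek3|nk3] := eqVneq k r.+3; [|lia]].
      subst k; rewrite /= /c' eqxx w2 !mul1n ltn_eqF // eqxx /=.
      case: (c r.+2) => [|x] /=; last by lia.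
      case: (c r.+1) => [|x] /=; first by rewrite !muln0; lia.
      by rewrite subn1 mulnS; lia.
    subst k; rewrite /= /c' eqxx w2 !mul1n !gtn_eqF // c0 // muln0.
    by lia.
  + move: ct; rewrite !(@big_nat_recr _ _ _ r.+2) // !(@big_nat_recr _ _ _ r.+1) //=.
    set s1 := \sum_(1 <= i < r.+1) c i; set s2 := \sum_(1 <= i < r.+1) c' i.
    have ->: s2 = s1 by apply: eq_big_nat => i ir; rewrite /c';
      do 2 (case: eqP => [|_]; first by lia).
    by rewrite /c' eqxx ltn_eqF // eqxx; lia.
- exists (fun k => c k + (k == r.+2)); split=> [k rk|k k0|].
  + by rewrite c0 // gtn_eqF.
  + have [kr|rk] := leqP k r.+3; last by rewrite !c0 ?muln0; lia.
    rewrite ab ?k0 //; have := ca k k0.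
    have [ek2|nk2] := eqVneq k r.+2; [subst k|have [ek3|nk3] := eqVneq k r.+3; [subst k|]].
    * by rewrite /= w2; lia.
    * by rewrite /= eqxx w2; lia.
    * have /negbTE->: k.-1 != r.+2 by lia.
      by rewrite !addn0.
  + move: ct; rewrite !(@big_nat_recr _ _ _ r.+2) //= eqxx.
    set s1 := \sum_(1 <= i < r.+2) c i; set s2 := \sum_(1 <= i < r.+2) _.
    have ->: s2 = s1 by apply: eq_big_nat => i ir; rewrite ltn_eqF ?addn0 //; lia.
    by lia.
Qed.

Lemma path_power_last0 r t a : 0 < w r.+1 -> a r.+2 = 0 ->
  path_power r.+2 t a <-> path_power r.+1 t a.
Proof.
move=> w1 a0; split=> -[c [c0 ca ct]]; exists c.
  have cr : c r.+1 = 0 by have := ca r.+2 isT; rewrite a0 /=; nia.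
  split=> // [k|]; last by move: ct; rewrite (@big_nat_recr _ _ _ r.+1) //= cr addn0.
  by rewrite leq_eqVlt => /orP[/eqP<-|/c0].
split=> // [k rk|]; first by apply: c0; apply: ltnW.
by rewrite (@big_nat_recr _ _ _ r.+1) //=; lia.
Qed.

(** Both edges at [x_(r+2)] drop out, and [x_(r+3)] becomes isolated. *)
Lemma path_power_penultimate0 r t a : 0 < w r.+1 -> 0 < w r.+2 -> a r.+2 = 0 ->
  path_power r.+3 t a <-> path_power r.+1 t a.
Proof.
move=> w1 w2 a0; split=> -[c [c0 ca ct]]; exists c.
  have [cr1 cr2] : c r.+1 = 0 /\ c r.+2 = 0 by have := ca r.+2 isT; rewrite a0 /=; nia.
  split=> // [k rk|].
    have [->|n1] := eqVneq k r.+1; first exact: cr1.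
    have [->|n2] := eqVneq k r.+2; first exact: cr2.
    by apply: c0; lia.
  move: ct; rewrite (@big_nat_recr _ _ _ r.+2) // (@big_nat_recr _ _ _ r.+1) //=.
  by rewrite cr1 cr2 !addn0.
split=> // [k rk|]; first by apply: c0; lia.
by rewrite (@big_nat_recr _ _ _ r.+2) // (@big_nat_recr _ _ _ r.+1) //=; lia.
Qed.

Lemma path_power_edgeless r t a : r <= 1 -> ~ path_power r t.+1 a.
Proof. by case: r => [|[|//]] _ [c [_ _]]; rewrite big_geq. Qed.

Lemma path_power2 t a :
  path_power 2 t a <-> w 1 * t <= a 1 /\ w 1 * t <= a 2.
Proof.
split=> [[c [c0 ca]]|[a1 a2]].
  rewrite big_nat1 => ct; have := ca 1 isT; have := ca 2 isT; rewrite /=.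
  by have := leq_mul (leqnn (w 1)) ct; lia.
exists (fun k => if k == 1 then t else 0); split=> [[|[|k]] //|[|[|[|k]]] //= _|].
- by rewrite muln0.
- by rewrite muln0 addn0.
- by rewrite !muln0.
- by rewrite big_nat1.
Qed.

(** * Four vertices with [w 1, w 3 > 1] *)

Section FourVertices.
Hypotheses (w1 : 1 < w 1) (w2 : w 2 = 1) (w3 : 1 < w 3).

Let sum4 c : \sum_(1 <= i < 4) c i = c 1 + c 2 + c 3.
Proof. by rewrite unlock /= addn0 addnA. Qed.

Let path_power4_intro (c1 c2 c3 : nat) t a : w 1 * c1 <= a 1 -> w 1 * c1 + c2 <= a 2 ->
  c2 + w 3 * c3 <= a 3 -> w 3 * c3 <= a 4 -> t <= c1 + c2 + c3 ->
  path_power 4 t a.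
Proof.
move=> a1 a2 a3 a4 ct.
exists (fun k => if k is k'.+1 then nth 0 [:: c1; c2; c3] k' else 0).
split=> [[|[|[|[|k]]]] // _|[|[|[|[|[|k]]]]] //= _|];
  by rewrite /= ?nth_nil ?muln0 ?addn0 ?w2 ?mul1n ?sum4.
Qed.

Let path_power4_elim t a : path_power 4 t a -> exists c1 c2 c3 : nat,
  [/\ w 1 * c1 <= a 1, w 1 * c1 + c2 <= a 2, c2 + w 3 * c3 <= a 3,
      w 3 * c3 <= a 4 & t <= c1 + c2 + c3].
Proof.
move=> [c [c0 ca ct]]; exists (c 1), (c 2), (c 3); move: ct; rewrite sum4 => ct.
have := ca 1 isT; have := ca 2 isT; have := ca 3 isT; have := ca 4 isT.
by rewrite /= w2 mul1n; split=> //; lia.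
Qed.

(** The middle edge alone suffices, [(x_2 x_3)^t] being a divisor. *)
Lemma path_power4_total t a : t <= a 2 -> t <= a 3 -> path_power 4 t a.
Proof.
by move=> a2 a3; apply: (@path_power4_intro 0 t 0); rewrite ?muln0 ?addn0.
Qed.

(* [(x_1 x_2)^{w 1} (x_3 x_4)^{w 3}] is a multiple of [(x_2 x_3)^2], so the edges
   1 and 3 need not be used together. *)
Lemma path_power4_slice2 k t a : k < t -> a 2 = k -> t <= a 3 ->
  path_power 4 t a <-> t + (w 3).-1 * (t - k) <= a 3 /\ w 3 * (t - k) <= a 4.
Proof.
move=> kt a2 a3; split=> [/path_power4_elim[c1 [c2 [c3]]] [b1 b2 b3 b4 ct]|[b3 b4]].
  have [v ev] : exists v, w 3 = v.+2 by exists (w 3 - 2); lia.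
  have [u eu] : exists u, w 1 = u.+2 by exists (w 1 - 2); lia.
  rewrite ev eu /= in b1 b2 b3 b4 *; have c3' : t - k + c1 <= c3 by nia.
  by split; nia.
apply: (@path_power4_intro 0 k (t - k)); rewrite ?muln0 ?add0n ?a2 //; last by lia.
by have [v ev] : exists v, w 3 = v.+1; [by exists (w 3 - 1); lia|rewrite ev /= in b3 *; nia].
Qed.

(** The mirror image of the slice in [x_2]: the best choice uses edge 2 [k] times and edge 1 for the
    remaining [t - k]. *)
Lemma path_power4_slice3 k t a : k < t -> a 3 = k ->
  path_power 4 t a <-> w 1 * (t - k) <= a 1 /\ t + (w 1).-1 * (t - k) <= a 2.
Proof.
move=> kt a3; split=> [/path_power4_elim[c1 [c2 [c3]]] [b1 b2 b3 b4 ct]|[b1 b2]].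
  have [v ev] : exists v, w 3 = v.+2 by exists (w 3 - 2); lia.
  have [u eu] : exists u, w 1 = u.+2 by exists (w 1 - 2); lia.
  (* [w 3 >= 2] gives [c2 + 2 * c3 <= k], so every use of edge 3 costs an additional use of edge
     1. *)
  rewrite ev eu /= in b1 b2 b3 b4 *; have c1' : t - k + c3 <= c1 by nia.
  by split; nia.
apply: (@path_power4_intro (t - k) k 0); rewrite ?muln0 ?addn0 ?a3 //; last by lia.
by have [v ev] : exists v, w 1 = v.+1; [by exists (w 1 - 1); lia|rewrite ev /= in b2 *; nia].
Qed.

End FourVertices.
End PathPowers.

(** * Filtering the powers of a path ideal *)

Section PathFiltration.
Local Open Scope nat_scope.
Variables (K : fieldType) (n : nat) (w : nat -> nat).
Local Notation S := {mpoly K[n]}.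
Local Notation mnm := 'X_{1..n}.
Implicit Types (F : {set 'I_n}) (u v m : mnm) (j : 'I_n) (r t k d : nat).

(* The exponent of [x_k], [1 <= k <= n]; junk value [0] for [k > n]. *)
Definition expo m k : nat := oapp (fun j : 'I_n => m j) 0 (insub k.-1).

Lemma expo_ord m j : expo m j.+1 = m j.
Proof. by rewrite /expo /= valK. Qed.

Lemma expoD m u k : expo (m + u)%MM k = expo m k + expo u k.
Proof. by rewrite /expo; case: insub => //= j; rewrite mnmDE. Qed.

Lemma expoB m u k : expo (m - u)%MM k = expo m k - expo u k.
Proof. by rewrite /expo; case: insub => //= j; rewrite mnmBE. Qed.

Lemma expoMn u N k : expo (u *+ N)%MM k = expo u k * N.
Proof. by rewrite /expo; case: insub => //= j; rewrite mulmnE. Qed.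

Lemma expoU j k : 0 < k -> expo U_(j)%MM k = (k == j.+1).
Proof.
case: k => // k _; rewrite /expo /= eqSS; case: insubP => [i _ <-|].
  by rewrite /= mnm1E (inj_eq val_inj) eq_sym.
by case: eqP => // -> /negP[].
Qed.

Lemma lem_expoP u m :
  reflect (forall k, 0 < k <= n -> expo u k <= expo m k) (u <= m)%MM.
Proof.
apply: (iffP mnm_lepP) => [um k _|um j].
  by rewrite /expo; case: insub => //= j.
by rewrite -!expo_ord; apply: um; rewrite /= ltn_ord.
Qed.

Definition path_ideal r t m : Prop := path_power w r t (expo m).

Lemma up_closed_path r t : up_closed (path_ideal r t).
Proof. by move=> m v; apply: path_power_le => k _; rewrite expoD leq_addr. Qed.

(** The vertices [x_1, ..., x_r] survive: ordinals count from 0, so [j] stands for [x_(j+1)]. *)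
Definition avoids F r : Prop := forall j, j \in F -> r <= j.

Lemma card_setU1 F j : j \notin F -> #|j |: F| = #|F|.+1.
Proof. by move=> jF; rewrite cardsU1 jF. Qed.

Lemma avoids_notin F r j : avoids F r -> j < r -> j \notin F.
Proof. by move=> Fr jr; apply/negP=> /Fr; rewrite leqNgt jr. Qed.

Lemma avoidsU1 F r j : r <= j -> avoids F r -> avoids (j |: F) r.
Proof. by move=> rj Fr i /setU1P[->|/Fr]. Qed.

Lemma avoidsW F r r' : r' <= r -> avoids F r -> avoids F r'.
Proof. by move=> r'r Fr j /Fr; apply: leq_trans. Qed.

Lemma avoids_meets F r u : avoids F r -> (forall j, r <= j -> u j = 0) ->
  ~~ meets F u.
Proof. by move=> Fr u0; apply/meetsPn=> j /Fr/u0. Qed.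

Variable d : nat.
Local Notation regular := (mesym_regular K d).

(** Split at the last edge, whose colon is the previous power, then at its inner vertex. Here [y] is
    [x_(r+2)] and [z] is the leaf [x_(r+3)]. *)
Lemma regular_path_last r t F (y z : 'I_n) : y = r.+1 :> nat -> z = r.+2 :> nat ->
  w r.+2 = 1 -> 0 < w r.+1 -> avoids F r.+3 ->
  regular F (path_ideal r.+3 t) ->
  regular (z |: F) (fun m => path_ideal r.+2 t.+1 (m + U_(y))%MM) ->
  regular (y |: F) (path_ideal r.+1 t.+1) ->
  regular F (path_ideal r.+3 t.+1).
Proof.
move=> yr zr w2 w1 Fr Rt Rz Ry.
have upP := @up_closed_path r.+3 t.+1.
apply: (mesym_regular_split (u := (U_(y) + U_(z))%MM)) => //.
- apply: (avoids_meets Fr) => j rj; rewrite mnmDE !mnm1E -!val_eqE /= yr zr.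
  by do 2 (case: eqP => [|_]; first lia).
- apply: mesym_regular_ext Rt => m _; symmetry; apply: path_power_leaf_colon => //.
  move=> k /andP[k0 _]; rewrite !expoD !expoU // yr zr.
  by rewrite addnA.
apply: (mesym_regular_split_var (j := y)).
- by apply: up_closedU => //; apply: up_closed_le.
- by apply: (avoids_notin Fr); rewrite yr.
(* After division by [x_y] the added generator [x_y x_z] becomes [x_z], so [z] is killed and the
   last edge drops out. *)
- apply: (@mesym_regular_ext _ _ _ _
    (fun m => path_ideal r.+3 t.+1 (m + U_(y))%MM \/ (U_(z) <= m)%MM)).
    move=> m _; rewrite addmC.
    suff ->: (U_(z) <= m)%MM = (U_(y) + U_(z) <= U_(y) + m)%MM by [].
    by apply/mnm_lepP/mnm_lepP=> um i; move: (um i); rewrite !mnmDE leq_add2l.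
  apply: mesym_regular_var; apply: mesym_regular_ext Rz => m.
  rewrite meetsU1 negb_or -eqn0Ngt => /andP[/eqP mz _].
  symmetry; apply: path_power_last0; first by rewrite w2.
  by rewrite expoD expoU // yr -zr expo_ord mz zr gtn_eqF.
- apply: mesym_regular_ext Ry => m.
  rewrite meetsU1 negb_or -eqn0Ngt => /andP[/eqP my _].
  have e : path_ideal r.+3 t.+1 m <-> path_ideal r.+1 t.+1 m.
    by apply: path_power_penultimate0; rewrite ?w2 // -yr expo_ord.
  split=> [/e|]; first by left.
  case=> [/e//|/mnm_lepP/(_ y)]; rewrite mnmDE !mnm1E eqxx my; lia.
Qed.

(** Splitting at [x_(r+2)] turns the colon by the leaf into the colon by the whole last edge. *)
Lemma regular_path_colon_last r t F (y z : 'I_n) :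
  y = r.+1 :> nat -> z = r.+2 :> nat ->
  w r.+2 = 1 -> 0 < w r.+1 -> avoids F r.+3 ->
  regular F (path_ideal r.+3 t) ->
  regular (y |: F) (path_ideal r.+1 t.+1) ->
  regular F (fun m => path_ideal r.+3 t.+1 (m + U_(z))%MM).
Proof.
move=> yr zr w2 w1 Fr Rt Ry.
apply: (mesym_regular_split_var (j := y)).
- by apply: up_closed_shift; apply: up_closed_path.
- by apply: (avoids_notin Fr); rewrite yr.
- apply: mesym_regular_ext Rt => m _; symmetry; apply: path_power_leaf_colon => //.
  by move=> k /andP[k0 _]; rewrite !expoD !expoU // yr zr.
- apply: mesym_regular_ext Ry => m.
  rewrite meetsU1 negb_or -eqn0Ngt => /andP[/eqP my _].
  (* The leaf [x_(r+3)] lies off the path on [r + 1] vertices, so its exponent does not matter. *)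
  transitivity (path_ideal r.+1 t.+1 (m + U_(z))%MM).
    split; apply: path_power_le => k /andP[k0 kr]; rewrite expoD expoU // zr //.
      by rewrite leq_addr.
    by rewrite ltn_eqF ?addn0 //; lia.
  symmetry; apply: path_power_penultimate0; rewrite ?w2 //.
  by rewrite expoD expoU // zr -yr expo_ord my ltn_eqF // yr.
Qed.

(** The second and third pieces come from [I_(r+3)^(t+1) : x_(r+3)] modulo [x_(r+4)]. The third
    leaves [y] free, the fourth leaves [z] free. *)
Lemma regular_path_step r t F (x y z : 'I_n) :
  x = r.+1 :> nat -> y = r.+2 :> nat -> z = r.+3 :> nat ->
  w r.+3 = 1 -> w r.+2 = 1 -> 0 < w r.+1 -> avoids F r.+4 ->
  regular F (path_ideal r.+4 t) ->
  regular (z |: F) (path_ideal r.+3 t) ->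
  regular (x |: (z |: F)) (path_ideal r.+1 t.+1) ->
  regular (y |: F) (path_ideal r.+2 t.+1) ->
  regular F (path_ideal r.+4 t.+1).
Proof.
move=> xr yr zr w3 w2 w1 Fr Rt Rz Rx Ry.
apply: (@regular_path_last r.+1 t F y z) => //; first by rewrite w2.
apply: (@regular_path_colon_last r t _ x y) => //.
by apply: avoidsU1; [rewrite zr|apply: avoidsW Fr].
Qed.

(** * Short paths and the inductions on the number of vertices *)

Let regP : polynomial_rings_regular K n d := @mesym_polynomial_rings K n d.

Lemma regular_path_edgeless r t F : r <= 1 -> #|F| + d <= n ->
  regular F (path_ideal r t.+1).
Proof. by move=> r1 Fd; apply: regP => // m _; apply: path_power_edgeless. Qed.

Lemma regular_path_power0 r F : regular F (path_ideal r 0).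
Proof. by apply: mesym_regular_total => m _; apply: path_power0. Qed.

Lemma regular_principal2 (x y : 'I_n) A B F (U : mnm -> Prop) : x != y ->
  x \notin F -> y \notin F -> #|F| + 1 + d <= n ->
  (forall m, ~~ meets F m -> U m <-> A <= m x /\ B <= m y) -> regular F U.
Proof.
move=> xy xF yF Fd UAB.
have uE (i : 'I_n) : (U_(x) *+ A + U_(y) *+ B)%MM i = (x == i) * A + (y == i) * B.
  by rewrite mnmDE !mulmnE !mnm1E.
apply: (mesym_regular_principal regP (u := (U_(x) *+ A + U_(y) *+ B)%MM)) => //.
  move=> m /UAB->; split=> [[Ax By]|/mnm_lepP um].
    apply/mnm_lepP=> i; rewrite uE; case: eqP => [<-|_].
      by rewrite eq_sym (negbTE xy); lia.
    by case: eqP => [<-|_]; lia.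
  by move: (um x) (um y); rewrite !uE !eqxx eq_sym (negbTE xy) mul1n mul0n addn0 mul1n add0n.
apply/meetsPn=> i iF; rewrite uE.
by do 2 (case: eqP => [e|_]; first by rewrite e iF in xF yF).
Qed.

(** The colon by [x_2^k] only lowers the exponent of [x_2] in the generator of a principal ideal. *)
Lemma regular_path2 t k F (x y : 'I_n) : x = 0 :> nat -> y = 1 :> nat ->
  avoids F 2 -> #|F| + 1 + d <= n ->
  regular F (fun m => path_ideal 2 t (m + U_(y) *+ k)%MM).
Proof.
move=> x0 y1 F2 Fd.
apply: (@regular_principal2 x y (w 1 * t) (w 1 * t - k)) => //.
- by rewrite -val_eqE /= x0 y1.
- by apply: (avoids_notin F2); rewrite x0.
- by apply: (avoids_notin F2); rewrite y1.
move=> m _; rewrite /path_ideal path_power2 !expoD !expoMn !expoU // y1 /=.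
have -> : expo m 1 = m x by rewrite -expo_ord x0.
have -> : expo m 2 = m y by rewrite -expo_ord y1.
by rewrite mul0n addn0 mul1n leq_subLR addnC.
Qed.

(** Splitting off the last edge leaves an earlier power, the principal ideal [I_2^(t+1) : x_2]
    modulo [x_3], and the zero ideal modulo [x_2]. *)
Lemma regular_path3 t F (x y z : 'I_n) :
  x = 0 :> nat -> y = 1 :> nat -> z = 2 :> nat ->
  w 2 = 1 -> 0 < w 1 -> avoids F 3 -> #|F| + 2 + d <= n ->
  regular F (path_ideal 3 t).
Proof.
move=> x0 y1 z2 w2 w1 F3 Fd; elim: t => [|t IHt]; first exact: regular_path_power0.
have zF : z \notin F by apply: (avoids_notin F3); rewrite z2.
have yF : y \notin F by apply: (avoids_notin F3); rewrite y1.
apply: (@regular_path_last 0 t F y z) => //; last first.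
  by apply: regular_path_edgeless => //; rewrite (card_setU1 yF); lia.
have zF2 : avoids (z |: F) 2 by apply: avoidsU1; rewrite ?z2 //; apply: avoidsW F3.
have zFd : #|z |: F| + 1 + d <= n by rewrite (card_setU1 zF); lia.
apply: mesym_regular_ext (@regular_path2 t.+1 1 (z |: F) x y x0 y1 zF2 zFd) => m _.
by rewrite mulm1n.
Qed.

(** Splitting at [x_3^t] leaves a colon ideal, to be sliced in [x_2], and the slices in [x_3] below
    [t]. Each slice kills one variable and is principal, whence the summand 2. The colon by [x_4^k]
    is carried along for use on five vertices. *)
Lemma regular_path4 t k F (p q r s : 'I_n) :
  p = 0 :> nat -> q = 1 :> nat -> r = 2 :> nat -> s = 3 :> nat ->
  1 < w 1 -> w 2 = 1 -> 1 < w 3 -> avoids F 4 -> #|F| + 2 + d <= n ->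
  regular F (fun m => path_ideal 4 t (m + U_(s) *+ k)%MM).
Proof.
move=> p0 q1 r2 s3 w1 w2 w3 F4 Fd.
have notF (j : 'I_n) : j < 4 -> j \notin F by apply: avoids_notin.
have pF : p \notin F by apply: notF; rewrite p0.
have qF : q \notin F by apply: notF; rewrite q1.
have rF : r \notin F by apply: notF; rewrite r2.
have sF : s \notin F by apply: notF; rewrite s3.
have e1 m : expo m 1 = m p by rewrite -expo_ord p0.
have e2 m : expo m 2 = m q by rewrite -expo_ord q1.
have e3 m : expo m 3 = m r by rewrite -expo_ord r2.
have e4 m : expo m 4 = m s by rewrite -expo_ord s3.
have ne (i j : 'I_n) : (i == j) = (i == j :> nat) by rewrite -val_eqE.
have upP := up_closed_shift (u := (U_(s) *+ k)%MM) (@up_closed_path 4 t).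
apply: (mesym_regular_split (u := (U_(r) *+ t)%MM)) => //.
- apply: (avoids_meets F4) => j j4; rewrite mulmnE mnm1E ne r2.
  by case: eqP => //; lia.
- apply: (mesym_regular_slices (j := q) (N := t)) => //.
  + exact: (up_closed_shift upP).
  + apply: mesym_regular_total => m _; apply: path_power4_total => //.
      by rewrite e2 !mnmDE !mulmnE !mnm1E !ne q1 r2 s3; lia.
    by rewrite e3 !mnmDE !mulmnE !mnm1E !ne q1 r2 s3; lia.
  + move=> l lt.
    apply: (@regular_principal2 r s ((w 3).-1 * (t - l)) (w 3 * (t - l) - k)).
    * by rewrite ne r2 s3.
    * by rewrite in_setU1 negb_or rF ne r2 q1.
    * by rewrite in_setU1 negb_or sF ne s3 q1.
    * by rewrite (card_setU1 qF); lia.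
    move=> m; rewrite meetsU1 negb_or -eqn0Ngt => /andP[/eqP mq _].
    rewrite /path_ideal (@path_power4_slice2 w w1 w2 w3 l) //.
    * by rewrite e3 e4 !mnmDE !mulmnE !mnm1E !ne q1 r2 s3; lia.
    * by rewrite e2 !mnmDE !mulmnE !mnm1E !ne q1 r2 s3; lia.
    * by rewrite e3 !mnmDE !mulmnE !mnm1E !ne q1 r2 s3; lia.
- apply: (mesym_regular_slices (j := r) (N := t)) => //.
  + by apply: up_closedU => //; apply: up_closed_le.
  + by apply: mesym_regular_total => m _; right; rewrite lem_addl.
  + move=> l lt.
    apply: (@regular_principal2 p q (w 1 * (t - l)) (t + (w 1).-1 * (t - l))).
    * by rewrite ne p0 q1.
    * by rewrite in_setU1 negb_or pF ne p0 r2.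
    * by rewrite in_setU1 negb_or qF ne q1 r2.
    * by rewrite (card_setU1 rF); lia.
    move=> m; rewrite meetsU1 negb_or -eqn0Ngt => /andP[/eqP mr _].
    rewrite /path_ideal (@path_power4_slice3 w w1 w2 w3 l) //; last first.
      by rewrite e3 !mnmDE !mulmnE !mnm1E !ne r2 s3; lia.
    rewrite e1 e2 !mnmDE !mulmnE !mnm1E !ne p0 q1 r2 s3 /= !addn0.
    split; last by left.
    case=> // /mnm_lepP/(_ r); rewrite mnmDE !mulmnE mnm1E eqxx mr; lia.
Qed.

(** As [w 3 > 1], [regular_path_step] does not apply; splitting off the last edge leaves
    [I_4^(t+1) : x_4], covered by the four-vertex case with [k = 1]. *)
Lemma regular_path5 t F (p q r s z : 'I_n) :
  p = 0 :> nat -> q = 1 :> nat -> r = 2 :> nat -> s = 3 :> nat -> z = 4 :> nat ->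
  1 < w 1 -> w 2 = 1 -> 1 < w 3 -> w 4 = 1 -> avoids F 5 -> #|F| + 3 + d <= n ->
  regular F (path_ideal 5 t).
Proof.
move=> p0 q1 r2 s3 z4 w1 w2 w3 w4 F5 Fd.
elim: t => [|t IHt]; first exact: regular_path_power0.
have zF : z \notin F by apply: (avoids_notin F5); rewrite z4.
have sF : s \notin F by apply: (avoids_notin F5); rewrite s3.
apply: (@regular_path_last 2 t F s z) => //; first by apply: ltnW.
  have zF4 : avoids (z |: F) 4 by apply: avoidsU1; rewrite ?z4 //; apply: avoidsW F5.
  have zFd : #|z |: F| + 2 + d <= n by rewrite (card_setU1 zF); lia.
  have R4 := @regular_path4 t.+1 1 (z |: F) p q r s p0 q1 r2 s3 w1 w2 w3 zF4 zFd.
  by apply: mesym_regular_ext R4 => m _; rewrite mulm1n.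
apply: (@regular_path3 t.+1 (s |: F) p q r) => //; first exact: ltnW.
- by apply: avoidsU1; rewrite ?s3 //; apply: avoidsW F5.
- by rewrite (card_setU1 sF); lia.
Qed.

(** The numerical condition bounds [d] by the depth bound for [I_r^t] plus the [n - r - #|F|]
    variables that are free beyond the path. *)
Lemma regular_path_trivial_tail r t F : 0 < w 1 ->
  (forall i, 1 < i < n -> w i = 1) -> r <= n -> avoids F r ->
  d + r + #|F| <= n + maxn ((r.+1 - t + 2) %/ 3) (0 < r) ->
  regular F (path_ideal r t).
Proof.
move=> w1 wi.
elim/ltn_ind: r t F => r IHr; elim=> [|t IHt] F rn Fr bd; first exact: regular_path_power0.
have [r1|] := leqP r 1.
  by apply: regular_path_edgeless => //; case: r r1 bd {IHr IHt rn Fr} => [|[|//]] _ /=; lia.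
case: r IHr IHt rn Fr bd => [|[|[|[|r]]]] // IHr IHt rn Fr bd _.
- have lt1 : 0 < n by lia.
  have Fd : #|F| + 1 + d <= n by lia.
  have R2 := @regular_path2 t.+1 0 F (Ordinal lt1) (Ordinal rn) erefl erefl Fr Fd.
  by apply: mesym_regular_ext R2 => m _; rewrite mulm0n addm0.
- have lt1 : 0 < n by lia.
  have lt2 : 1 < n by lia.
  apply: (@regular_path3 t.+1 F (Ordinal lt1) (Ordinal lt2) (Ordinal rn)) => //; last by lia.
  by apply: wi; rewrite rn andbT.
have lt1 : r.+1 < n by lia.
have lt2 : r.+2 < n by lia.
pose x := Ordinal lt1; pose y := Ordinal lt2; pose z := Ordinal rn.
have xF : x \notin F by apply: (avoids_notin Fr) => /=; lia.
have yF : y \notin F by apply: (avoids_notin Fr) => /=; lia.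
have zF : z \notin F by apply: (avoids_notin Fr) => /=; lia.
have xzF : x \notin z |: F by rewrite in_setU1 negb_or xF -val_eqE /=; lia.
apply: (@regular_path_step r t F x y z) => //; try by apply: wi; lia.
- by have [->//|r0] := posnP r; rewrite wi; lia.
- by apply: IHt => //; lia.
- apply: IHr; rewrite ?(card_setU1 zF) //; try lia.
  by apply: avoidsU1 => //; apply: avoidsW Fr.
(* The tight piece: three vertices leave the path, two are killed and one stays free, which accounts
   for the division by 3. *)
- apply: IHr; rewrite ?(card_setU1 xzF) ?(card_setU1 zF); try lia.
  by do 2 (apply: avoidsU1 => /=; first by lia); apply: avoidsW Fr; lia.
- apply: IHr; rewrite ?(card_setU1 yF) //; try lia.
  by apply: avoidsU1 => //; apply: avoidsW Fr; lia.
Qed.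

(** The step needs weight 1 on the last two edges, so it starts at six vertices and its pieces have
    at least three. The lower bound [minn (r - 2) 2] is 1 on three vertices and 2 from four on. *)
Lemma regular_path_two_weights r t F : 1 < w 1 -> w 2 = 1 -> 1 < w 3 ->
  (forall i, 3 < i < n -> w i = 1) -> 3 <= r <= n -> avoids F r ->
  d + r + #|F| <= n + maxn ((r.+1 - t + 2) %/ 3) (minn (r - 2) 2) ->
  regular F (path_ideal r t).
Proof.
move=> w1 w2 w3 wi.
elim/ltn_ind: r t F => r IHr; elim=> [|t IHt] F /andP[r3 rn] Fr bd.
  exact: regular_path_power0.
have lt0 : 0 < n by lia.
have lt1 : 1 < n by lia.
have lt2 : 2 < n by lia.
pose x0 := Ordinal lt0; pose x1 := Ordinal lt1; pose x2 := Ordinal lt2.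
case: r IHr IHt r3 rn Fr bd => [|[|[|[|[|[|r]]]]]] // IHr IHt r3 rn Fr bd.
- by apply: (@regular_path3 t.+1 F x0 x1 x2) => //; lia.
- have Fd : #|F| + 2 + d <= n by lia.
  have R4 := @regular_path4 t.+1 0 F x0 x1 x2 (Ordinal rn) erefl erefl erefl erefl
    w1 w2 w3 Fr Fd.
  by apply: mesym_regular_ext R4 => m _; rewrite mulm0n addm0.
- have lt3 : 3 < n by lia.
  apply: (@regular_path5 t.+1 F x0 x1 x2 (Ordinal lt3) (Ordinal rn)) => //; last by lia.
  by apply: wi; lia.
have lt3 : r.+3 < n by lia.
have lt4 : r.+4 < n by lia.
pose x := Ordinal lt3; pose y := Ordinal lt4; pose z := Ordinal rn.
have xF : x \notin F by apply: (avoids_notin Fr) => /=; lia.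
have yF : y \notin F by apply: (avoids_notin Fr) => /=; lia.
have zF : z \notin F by apply: (avoids_notin Fr) => /=; lia.
have xzF : x \notin z |: F by rewrite in_setU1 negb_or xF -val_eqE /=; lia.
apply: (@regular_path_step r.+2 t F x y z) => //; try by apply: wi; lia.
- by have [->|r0] := posnP r; [apply: ltnW|rewrite wi; lia].
- by apply: IHt => //; lia.
- apply: IHr; rewrite ?(card_setU1 zF) //; try lia.
  by apply: avoidsU1 => //; apply: avoidsW Fr.
- apply: IHr; rewrite ?(card_setU1 xzF) ?(card_setU1 zF); try lia.
  by do 2 (apply: avoidsU1 => /=; first by lia); apply: avoidsW Fr; lia.
- apply: IHr; rewrite ?(card_setU1 yF) //; try lia.
  by apply: avoidsU1 => //; apply: avoidsW Fr; lia.
Qed.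

End PathFiltration.

(** * Ideals given by generators *)

Section Generators.
Local Open Scope ring_scope.
Variables (K : fieldType) (n : nat).
Local Notation S := {mpoly K[n]}.
Local Notation mnm := 'X_{1..n}.
Implicit Types (G s : seq S) (E : seq mnm) (f p : S) (m u : mnm).

Lemma in_ideal_nil p : in_ideal [::] p <-> p = 0.
Proof.
split=> [[c]|->]; first by rewrite big_ord0.
by exists (fun=> 0); rewrite big_ord0.
Qed.

Lemma in_ideal_cons f G p : in_ideal (f :: G) p <-> adjoin (in_ideal G) f p.
Proof.
split=> [[c ->]|[h [c e]]].
  exists (c ord0), (fun i => c (lift ord0 i)).
  by rewrite big_ord_recl /= addrAC subrr add0r.
exists (fun i => if unlift ord0 i is Some j then c j else h).
rewrite big_ord_recl /= unlift_none /=.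
under eq_bigr do rewrite liftK.
by rewrite -e addrC subrK.
Qed.

Lemma in_ideal_mem f G : f \in G -> in_ideal G f.
Proof.
elim: G => // g G IHG; rewrite inE => /orP[/eqP->|/IHG Gf]; apply/in_ideal_cons.
  exists 1; rewrite mul1r subrr; exists (fun=> 0).
  by rewrite big1 // => i _; rewrite mul0r.
exact: sub_adjoin.
Qed.

Lemma in_ideal_max G p : (forall f, f \in G -> in_max_ideal f) ->
  in_ideal G p -> in_max_ideal p.
Proof.
move=> maxG [c ->]; rewrite /in_max_ideal raddf_sum big1 // => i _ /=.
rewrite rmorphM /= [X in _ * X](_ : _ = 0) ?mulr0 //.
by apply: maxG; apply: mem_nth.
Qed.

Lemma in_ideal_rcons G f p : in_ideal (G ++ [:: f]) p <-> adjoin (in_ideal G) f p.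
Proof.
elim: G p => [|g G IHG] p /=; first exact: in_ideal_cons.
rewrite in_ideal_cons; split.
  move=> [h /IHG[k Gk]]; exists k; apply/in_ideal_cons; exists h.
  by have ->: p - k * f - h * g = p - h * g - k * f by ring.
move=> [h /in_ideal_cons[k Gk]]; exists k; apply/IHG; exists h.
by have ->: p - k * g - h * f = p - h * f - k * g by ring.
Qed.

(** Adjoining elements one at a time amounts to appending them to the generators; this yields the
    cancellation clause of [regular_seq]. *)
Lemma weakly_regular_in_ideal G s : weakly_regular (in_ideal G) s ->
  forall i, (i < size s)%N -> forall g,
    in_ideal (G ++ take i s) (s`_i * g) -> in_ideal (G ++ take i s) g.
Proof.
elim: s G => [//|f s IHs] G /= [Gf Gs] [|i] /= si g.
  by rewrite cats0; apply: Gf.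
rewrite -cat1s catA; apply: IHs => //.
by apply: eq_weakly_regular Gs => p; rewrite in_ideal_rcons.
Qed.

Lemma in_ideal_monomials E p : in_ideal [seq 'X_[u] | u <- E] p <->
  monomial_ideal (fun m => exists2 u, u \in E & (u <= m)%MM) p.
Proof.
elim: E p => [|u E IHE] p.
  rewrite in_ideal_nil; split=> [->|Up]; first by move=> m; rewrite msupp0.
  apply/eqP; rewrite -msupp_eq0; case e: (msupp p) => [//|m r].
  by have [|] := Up m; rewrite // e mem_head.
rewrite in_ideal_cons; transitivity
  (adjoin (monomial_ideal (fun m => exists2 u, u \in E & (u <= m)%MM)) 'X_[u] p).
  exact: eq_adjoin.
rewrite monomial_adjoin => [|m v [x xE xm]]; last first.
  by exists x => //; apply: lepm_trans xm (lem_addr _ _).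
apply: eq_monomial => m; split.
  by case=> [[x xE xm]|um]; [exists x|exists u]; rewrite ?inE ?xE ?eqxx ?orbT.
by move=> [x]; rewrite inE => /orP[/eqP->|xE] xm; [right|left; exists x].
Qed.

Fixpoint pow_exponents E t : seq mnm :=
  if t is t'.+1 then [seq (u + v)%MM | u <- E, v <- pow_exponents E t']
  else [:: 0%MM].

Lemma pow_gens_monomials E t :
  pow_gens [seq 'X_[u] | u <- E] t = [seq 'X_[u] | u <- pow_exponents E t] :> seq S.
Proof.
elim: t => [|t IHt] /=; first by rewrite mpolyX0.
rewrite IHt allpairs_mapl allpairs_mapr map_allpairs.
by apply: eq_allpairs => u v; rewrite mpolyXD.
Qed.

Definition edge_exponent (w : nat -> nat) (i : nat) : mnm :=
  [multinom ((j.+1 == i) + (j.+1 == i.+1)) * w i | j < n]%N.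

Lemma xvarE k (kn : (k < n)%N) : xvar K n k.+1 = 'X_(Ordinal kn).
Proof. by rewrite /xvar /= insubT. Qed.

Lemma wpath_gensE w : wpath_gens K n w =
  [seq 'X_[edge_exponent w i] | i <- iota 1 n.-1].
Proof.
apply/eq_in_map=> i; rewrite mem_iota => /andP[i1 i2].
case: i i1 i2 => // i _ i2.
have lt1 : (i < n)%N by lia.
have lt2 : (i.+1 < n)%N by lia.
rewrite (xvarE lt1) (xvarE lt2) -mpolyXD mpolyXn; congr 'X_[_].
apply/mnmP=> j; rewrite mulmnE mnmDE !mnm1E mnmE -!val_eqE /=.
by rewrite !eqSS (eq_sym i) (eq_sym i.+1).
Qed.

Lemma expo_edge w i k : (0 < k <= n)%N ->
  expo (edge_exponent w i) k = (((k == i) + (k == i.+1)) * w i)%N.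
Proof. by case: k => // k kn; rewrite (expo_ord _ (Ordinal kn)) mnmE. Qed.

Lemma sum_nat_eq i r : (0 < i < r)%N -> (\sum_(1 <= x < r) (x == i) = 1)%N.
Proof.
move=> ir; rewrite (bigD1_seq i) ?mem_index_iota ?iota_uniq //= eqxx.
by rewrite big1 // => x /negbTE->.
Qed.

(** A generator of the power is determined by how often each edge occurs; the induction on [t] adds
    or removes one occurrence. *)
Lemma pow_exponents_path w t m : (0 < n)%N ->
  (exists2 u, u \in pow_exponents [seq edge_exponent w i | i <- iota 1 n.-1] t &
    (u <= m)%MM) <-> path_ideal w n t m.
Proof.
move=> n0; elim: t m => [|t IHt] m.
  split=> [_|_]; first exact: path_power0.
  by exists 0%MM; rewrite ?mem_head //; apply/mnm_lepP=> i; rewrite mnm0E.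
split=> [[u /allpairsP[[e v] /= [/mapP[i] + -> vE ->]] um]|[c [c0 cm ct]]].
  rewrite mem_iota => /andP[i1 i2].
  have [|c [c0 cm ct]] := (IHt (m - edge_exponent w i)%MM).1.
    exists v => //; apply/mnm_lepP=> j; have /mnm_lepP/(_ j) := um.
    by rewrite mnmDE mnmBE; lia.
  exists (fun k => c k + (k == i))%N; split=> [k nk|k k0|].
  - by rewrite c0 // gtn_eqF //; lia.
  - have [kn|nk] := leqP k n; last by rewrite !c0 ?gtn_eqF //; lia.
    have kn' : (0 < k <= n)%N by rewrite k0.
    have /lem_expoP/(_ k kn') := um; rewrite expoD expo_edge //.
    have := cm k k0; rewrite expoB expo_edge //.
    have [->|ki] := eqVneq k i.
      have /negbTE->: i.-1 != i by lia.
      by rewrite (ltn_eqF (ltnSn i)) !addn0 mul1n mulnDr muln1; lia.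
    have [->|ki1] := eqVneq k i.+1; first by rewrite /= eqxx; nia.
    have /negbTE->: k.-1 != i by lia.
    by rewrite !addn0 subn0.
  - by rewrite big_split /= sum_nat_eq // ?addn1; lia.
(* The multiplicities sum to at least [t + 1], so some edge is used. *)
have [i /andP[i1 i_n] ci] : exists2 i, (0 < i < n)%N & (0 < c i)%N.
  have [i /andP[i1 ci]|c0'] := pickP (fun i : 'I_n => (0 < i) && (0 < c i))%N.
    by exists i; rewrite ?i1 ?ltn_ord.
  move: ct; rewrite big_nat_cond big1 // => i /andP[/andP[i1 i_n] _].
  by have := c0' (Ordinal i_n); rewrite /= i1 lt0n => /negbFE/eqP.
pose e := edge_exponent w i.
have em : (e <= m)%MM.
  apply/lem_expoP=> k kn; rewrite expo_edge //.
  have [k0 _] := andP kn; have := cm k k0.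
  have [->|_] := eqVneq k i; first by rewrite (ltn_eqF (ltnSn i)); nia.
  by have [->|_ _] := eqVneq k i.+1; rewrite //=; nia.
have [_ [|v vE vm]] := IHt (m - e)%MM; last first.
  exists (e + v)%MM; last first.
    by rewrite -(submK em) addmC; apply/mnm_lepP=> j; rewrite !mnmDE leq_add2r (mnm_lepP vm).
  by apply/allpairsP; exists (e, v); split=> //; apply: map_f; rewrite mem_iota; lia.
exists (fun k => c k - (k == i))%N; split=> [k nk|k k0|].
- by rewrite c0.
- have [kn|nk] := leqP k n; last by rewrite !c0 ?muln0; lia.
  have kn' : (0 < k <= n)%N by rewrite k0.
  have := cm k k0; rewrite expoB expo_edge //.
  have [->|ki] := eqVneq k i.
    have /negbTE->: i.-1 != i by lia.
    have := leq_pmulr (w i) ci.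
    by rewrite (ltn_eqF (ltnSn i)) subn0 mul1n mulnBr muln1; lia.
  have [->|ki1] := eqVneq k i.+1; first by rewrite /= eqxx; nia.
  have /negbTE->: k.-1 != i by lia.
  by rewrite !subn0.
(* Moving the indicators across leaves [c x <= (x == i) + (c x - (x == i))], true also when the
   subtraction truncates. *)
- have -> : (t = t.+1 - \sum_(1 <= x < n) (x == i))%N.
    by rewrite sum_nat_eq ?i1 // subn1.
  rewrite leq_subLR -big_split /=; apply: leq_trans ct _.
  by apply: leq_sum => x _; rewrite -leq_subLR.
Qed.

Lemma in_pow_wpath w t p : (0 < n)%N ->
  in_ideal (pow_gens (@wpath_gens K n w) t) p <->
  monomial_ideal (path_ideal w n t) p.
Proof.
move=> n0; rewrite wpath_gensE (map_comp (fun u : mnm => 'X_[u]) (edge_exponent w)).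
rewrite pow_gens_monomials in_ideal_monomials; apply: eq_monomial => m.
exact: pow_exponents_path.
Qed.

(** Beyond weak regularity, only properness is to be shown: all generators and all [e_i] with
    [i > 0] have zero constant term. *)
Lemma depth_ge_wpath d w t : (0 < n)%N -> (0 < t)%N ->
  (forall i, (1 <= i <= n.-1)%N -> (0 < w i)%N) ->
  mesym_regular K d (set0 : {set 'I_n}) (path_ideal w n t) ->
  depth_ge (pow_gens (@wpath_gens K n w) t) d.
Proof.
move=> n0 t0 w0 reg; exists (mesyms K n d); split; first exact: size_mesyms.
have max f : f \in mesyms K n d -> in_max_ideal f.
  move=> /mem_mesyms[e e0 ->]; rewrite /in_max_ideal mcoeff_mesym /mechar mdeg0.
  by rewrite eq_sym gtn_eqF.
split=> //; split.
  apply: weakly_regular_in_ideal; apply: eq_weakly_regular reg => p.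
  rewrite in_pow_wpath //; apply: eq_monomial => m.
  by split=> [[//|/meetsP[j]]|]; [rewrite inE|left].
(* If the zero exponent lay in [I^t], positive weights would force all multiplicities to vanish,
   against [t > 0]. *)
have I0 p : in_ideal (pow_gens (wpath_gens K n w) t) p -> in_max_ideal p.
  rewrite in_pow_wpath // => Up; apply: memN_msupp_eq0; apply/negP=> /Up.
  case=> c [c0 cm]; rewrite big_nat_cond big1 => [|i]; first by case: (t) t0.
  rewrite andbT => /andP[i1 i_n]; have := cm i i1.
  have := w0 i; rewrite i1 -ltnS prednK // => /(_ i_n).
  by rewrite /expo; case: insub => [j|] /=; rewrite ?mnm0E; nia.
have maxG f : f \in pow_gens (wpath_gens K n w) t ++ mesyms K n d -> in_max_ideal f.
  rewrite mem_cat => /orP[fG|/max//]; apply: I0.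
  exact: in_ideal_mem.
move=> /(in_ideal_max maxG); rewrite /in_max_ideal mcoeff1 eqxx.
by apply/eqP/oner_neq0.
Qed.

End Generators.

Theorem theorem4p17 (K : fieldType) (n : nat) (w : nat -> nat) :
  (5 <= n)%N ->
  (forall i, (1 <= i <= n.-1)%N -> (0 < w i)%N) ->
  integrally_closed (@wpath_gens K n w) ->
  (w 3 < w 1)%N ->
  (forall i, (1 <= i <= n.-1)%N -> i != 1%N -> i != 3%N -> w i = 1%N) ->
  forall t : nat, (1 <= t)%N ->
    (w 3 = 1%N ->
       depth_ge (pow_gens (@wpath_gens K n w) t)
                (maxn ((n.+1 - t + 2) %/ 3) 1)) /\
    ((1 < w 3)%N ->
       depth_ge (pow_gens (@wpath_gens K n w) t)
                (maxn ((n.+1 - t + 2) %/ 3) 2)).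
Proof.
move=> n5 w0 _ w31 wi t t0; have n0 : (0 < n)%N by apply: leq_trans n5.
have F0 : avoids (set0 : {set 'I_n}) n by move=> j; rewrite inE.
have w1 : (0 < w 1)%N by apply: leq_ltn_trans w31.
(* With [F] empty and [r = n], the numerical condition admits exactly the claimed [d]. In the first
   case only edge 1 has weight above 1; in the second, edges 1 and 3 do. *)
split=> w3; apply: depth_ge_wpath => //.
  apply: regular_path_trivial_tail => //; last by rewrite cards0 n0; lia.
  move=> i /andP[i1 i_n]; have [->//|i3] := eqVneq i 3%N.
  by apply: wi => //; lia.
apply: regular_path_two_weights => //; first exact: ltn_trans w31.
- by apply: wi => //; lia.
- by move=> i /andP[i3 i_n]; apply: wi; lia.
- by rewrite leqnn andbT; apply: leq_trans n5.
- by rewrite cards0 (_ : minn (n - 2) 2 = 2)%N; lia.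
Qed.
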